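(* Let $F(x,t)$ be a family of polynomials of the ''third kind'' with coefficients in $A$, that is, $$F(x,t)=x^2a_0+x^3a_1+2xb_0t+x^2b_1t+c_0t^2+xc_1t^2+d_1t^3+O(t^4),$$ where $a_0,a_1,b_0,b_1,c_0,c_1,d_1\in A$, $b_0^2-a_0c_0=0$ and $a_0(-a_1b_0^3+b_1b_0^2a_0-c_1b_0a_0^2+d_1a_0^3)\ne0$. Then $$\operatorname{Ver}(F)=-4(-a_1b_0^3+b_1b_0^2a_0-c_1b_0a_0^2+d_1a_0^3).$$
   Context: $k$ is an algebraically closed field of characteristic zero, $A$ is a $k$-algebra and integral domain, $K=\operatorname{Frac}(A)$ and $\overline K$ is an algebraic closure of $K$. Family of polynomials of degree $n'$ with coefficients in $A$: $F(x,t)=\sum_{i\ge0}F_i(x)t^i$ with $F_i\in A[x]$, $\deg F_0=n'$, $\deg F_i\le n'$ for $i>0$. View $F$ as a polynomial in $x$ of degree $n'$ over $A[[t]]$ with leading coefficient $u(t)$. The $t$-roots of $F$ are its $n'$ roots in $\bigcup_N\overline K((t^{1/N}))$; they lie in $\bigcup_N\overline K[[t^{1/N}]]$, and their constant terms are the roots of $F_0$. For a nonzero Puiseux series $g$ in $t$, $g_0$ is the coefficient of its lowest power of $t$. For $h=a_p\prod_{i=1}^p(x-\alpha_i)$ and $g$ of degree $m$, $\operatorname{Res}(h,g)=a_p^m\prod_ig(\alpha_i)$. Vertex: for $F_0=\prod_\nu f_\nu^{n_\nu}$ with $f_\nu$ coprime having roots $a_{\nu\ell}$, $\operatorname{Ver}(F):=\prod_{\nu,\ell}\Delta(F,f_\nu)(a_{\nu\ell},t)_0\prod_{\nu<\nu'}\operatorname{Res}(f_\nu,f_{\nu'})^{2(n_\nu+n_{\nu'}-n_\nu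 n_{\nu'})}$, where $\Delta(F,f_\nu)$ is the generalized formal discriminant: writing $F=Q\prod_{i=1}^{n_\nu}(f_\nu-s_i'(x,t))$ with $Q$ collecting $u(t)$ and the factors $(x-s)$ for the $t$-roots $s$ with $f_\nu(s(0))\neq0$, $\Delta(F,f_\nu)(x,t)$ is the discriminant in $w$ of $Q\prod_i(w-s_i')$, namely $Q^{2n_\nu-2}\prod_{i<j}(s_i'-s_j')^2$. Here the factorization used is $f_1=x$, $n_1=2$ and $f_2=a_1x+a_0$, $n_2=1$. Since $n_2=1$, $\Delta(F,f_2)=1$. If $s_1,s_2$ are the two $t$-roots with constant term $0$, and $s_j$ ($j\ge3$) the remaining $t$-roots, then $\Delta(F,x)(0,t)=\big[u(t)\prod_{j\ge3}(-s_j)\big]^{2}(s_1-s_2)^2$. Hence $\operatorname{Ver}(F)=\Delta(F,x)(0,t)_0\cdot\operatorname{Res}(x,a_1x+a_0)^{2(2+1-2)}$, with $\operatorname{Res}(x,a_1x+a_0)=a_0$. *)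

(* Defs.v *)
From HB Require Import structures.
From mathcomp Require Import all_boot all_order all_algebra.
From mathcomp Require Import boolp classical_sets.

Set Implicit Arguments.
Unset Strict Implicit.
Unset Printing Implicit Defensive.

Import GRing.Theory.
Local Open Scope ring_scope.

(* Formal power series in one variable; equality and choice are classical. *)
Record fps (R : Type) := Fps { fcoef : nat -> R }.

Section FpsRing.
Variable R : comNzRingType.

HB.instance Definition _ := gen_eqMixin (fps R).
HB.instance Definition _ := gen_choiceMixin (fps R).

Implicit Types f g h : fps R.

Lemma fps_eq f g : (forall n, fcoef f n = fcoef g n) -> f = g.
Proof. by case: f g => [f] [g] fg; congr Fps; apply/funext. Qed.

Definition fps_const (a : R) : fps R := Fps (fun n => if n == 0%N then a else 0).
Definition fps_add f g : fps R := Fps (fun n => fcoef f n + fcoef g n).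
Definition fps_opp f : fps R := Fps (fun n => - fcoef f n).
Definition fps_mul f g : fps R :=
  Fps (fun n => \sum_(i < n.+1) fcoef f i * fcoef g (n - i)).

Fact fps_addA : associative fps_add.
Proof. by move=> f g h; apply: fps_eq => n /=; rewrite addrA. Qed.

Fact fps_addC : commutative fps_add.
Proof. by move=> f g; apply: fps_eq => n /=; rewrite addrC. Qed.

Fact fps_add0 : left_id (fps_const 0) fps_add.
Proof. by move=> f; apply: fps_eq => n /=; case: ifP; rewrite add0r. Qed.

Fact fps_addN : left_inverse (fps_const 0) fps_opp fps_add.
Proof. by move=> f; apply: fps_eq => n /=; rewrite addNr; case: ifP. Qed.

HB.instance Definition _ :=
  GRing.isZmodule.Build (fps R) fps_addA fps_addC fps_add0 fps_addN.

Definition fps_trunc (m : nat) f : {poly R} := \poly_(i < m.+1) fcoef f i.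

Lemma fps_trunc_coef m f n : (n <= m)%N -> (fps_trunc m f)`_n = fcoef f n.
Proof. by move=> le_nm; rewrite coef_poly ltnS le_nm. Qed.

Lemma fps_mul_trunc m f g n : (n <= m)%N ->
  fcoef (fps_mul f g) n = (fps_trunc m f * fps_trunc m g)`_n.
Proof.
move=> le_nm; rewrite coefM /=; apply: eq_bigr => i _.
by rewrite !fps_trunc_coef // (leq_trans _ le_nm) ?leq_subr // -ltnS.
Qed.

Fact fps_mulA : associative fps_mul.
Proof.
move=> f g h; apply: fps_eq => n.
transitivity ((fps_trunc n f * (fps_trunc n g * fps_trunc n h))`_n).
  rewrite coefM /=; apply: eq_bigr => i _.
  by rewrite fps_trunc_coef -1?ltnS // -fps_mul_trunc // leq_subr.
rewrite mulrA coefM /=; apply: eq_bigr => i _.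
by rewrite (fps_trunc_coef h) ?leq_subr // -fps_mul_trunc -1?ltnS.
Qed.

Fact fps_mulC : commutative fps_mul.
Proof.
by move=> f g; apply: fps_eq => n; rewrite !(@fps_mul_trunc n) // mulrC.
Qed.

Fact fps_mul1 : left_id (fps_const 1) fps_mul.
Proof.
move=> f; apply: fps_eq => n /=.
rewrite big_ord_recl /= subn0 mul1r big1 ?addr0 // => i _.
by rewrite mul0r.
Qed.

Fact fps_mulDl : left_distributive fps_mul fps_add.
Proof.
move=> f g h; apply: fps_eq => n /=; rewrite -big_split /=.
by apply: eq_bigr => i _; rewrite mulrDl.
Qed.

Fact fps_1neq0 : fps_const 1 != fps_const 0.
Proof.
apply/eqP => /(congr1 (fun f => fcoef f 0%N)) /= /eqP.
by rewrite oner_eq0.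
Qed.

HB.instance Definition _ := GRing.Zmodule_isComNzRing.Build (fps R)
  fps_mulA fps_mulC fps_mul1 fps_mulDl fps_1neq0.

(* The coefficient of the lowest power of the variable (0 if f = 0). *)
Definition fps_low f : R :=
  match pselect (exists n, fcoef f n != 0) with
  | left nz_f => fcoef f (ex_minn nz_f)
  | right _ => 0
  end.

End FpsRing.

(* F i is the coefficient of t^i, a polynomial in x.                          *)
Definition poly_family (A : idomainType) (n : nat) (F : nat -> {poly A}) : Prop :=
  size (F 0%N) = n.+1 /\ forall i, (size (F i) <= n.+1)%N.

Section Vertex.
Variables (A : idomainType) (L : closedFieldType).
Variable iota : {rmorphism {fraction A} -> L}.
Local Notation j := (fun a : A => iota (tofrac a)).

Implicit Types (F : nat -> {poly A}) (f g : {poly A}) (N n : nat).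

(* Image of h(t) under A[[t]] -> L[[t^(1/N)]]. An element of L[[t^(1/N)]] is   *)
(* encoded as a power series in tau = t^(1/N), so that t = tau^N.              *)
Definition ramify N (h : fps A) : fps L :=
  Fps (fun m => if (N %| m)%N then j (fcoef h (m %/ N)) else 0).

(* F as a polynomial in x of degree deg F_0 over A[[t]], then over             *)
(* L[[t^(1/N)]]; the leading coefficient of the latter is u(t).                *)
Definition xpoly F : {poly fps A} :=
  \poly_(i < size (F 0%N)) Fps (fun m => (F m)`_i).
Definition rpoly N F : {poly fps L} := map_poly (ramify N) (xpoly F).

(* rs lists the t-roots of F with multiplicity, all in L[[t^(1/N)]].           *)
Definition t_roots N F (rs : seq (fps L)) : Prop :=
  rpoly N F = lead_coef (rpoly N F) *: \prod_(s <- rs) ('X - s%:P).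

Definition res_roots f : seq L := sval (closed_field_poly_normal (map_poly j f)).

Definition Res f g : L :=
  j (lead_coef f) ^+ (size g).-1 * \prod_(a <- res_roots f) (map_poly j g).[a].

(* D = Delta(F, f) for a factor f of multiplicity n of F_0: writing            *)
(* F = Q * prod_(i < n) (f - s_i), where f - s_i collects t-roots of F lying   *)
(* over the roots of f (so that s_i(x, 0) = 0 and deg s_i < deg f), D is the   *)
(* discriminant in w of Q * prod_i (w - s_i). For monic f, Q is u(t) times     *)
(* the product of the (x - s) with f(s(0)) <> 0; in general the leading        *)
(* coefficients of the factors f - s_i have to be taken out of u(t).           *)
Definition is_gen_disc N F (rs : seq (fps L)) f n (D : {poly fps L}) : Prop :=
  exists (Q : {poly fps L}) (s : 'I_n -> {poly fps L}),
    let fL := map_poly (fun a => fps_const (j a)) f in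
    [/\ lead_coef fL ^+ n *: Q = lead_coef (rpoly N F) *:
          \prod_(r <- rs | ~~ root (map_poly j f) (fcoef r 0%N)) ('X - r%:P),
        rpoly N F = Q * \prod_(i < n) (fL - s i),
        forall i, (size (s i) <= (size f).-1)%N
          /\ (forall l, fcoef (s i)`_l 0%N = 0)
      & D = Q ^+ (2 * n - 2) *
            \prod_(i < n) \prod_(i' < n | (i < i')%N) (s i - s i') ^+ 2].

(* A factorization of F_0 is given as the sequence of pairs (f_nu, n_nu).      *)
Definition is_factorization F (fs : seq ({poly A} * nat)) : Prop :=
  [/\ F 0%N = \prod_(p <- fs) p.1 ^+ p.2,
      all (fun p => 0 < p.2)%N fs
    & pairwise (fun p q => coprimep (map_poly j p.1) (map_poly j q.1)) fs].

Definition is_vertex F (fs : seq ({poly A} * nat)) (v : L) : Prop :=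
  is_factorization F fs /\
  let f (nu : 'I_(size fs)) := (nth (0, 0%N) fs nu).1 in
  let n (nu : 'I_(size fs)) := (nth (0, 0%N) fs nu).2 in
  exists N (rs : seq (fps L)) (D : 'I_(size fs) -> {poly fps L}),
    [/\ (0 < N)%N, t_roots N F rs,
        forall nu, is_gen_disc N F rs (f nu) (n nu) (D nu)
      & v = (\prod_(nu < size fs) \prod_(a <- res_roots (f nu))
               fps_low (D nu).[fps_const a])
          * \prod_(nu < size fs) \prod_(nu' < size fs | (nu < nu')%N)
              Res (f nu) (f nu') ^
              (2 * ((n nu)%:Z + (n nu')%:Z - (n nu)%:Z * (n nu')%:Z))].

Definition Ver F (fs : seq ({poly A} * nat)) : L :=
  xget 0 [set v | is_vertex F fs v]%classic.

End Vertex.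

(* Main.v *)
Require Import Defs.
From HB Require Import structures.
From mathcomp Require Import all_boot all_order all_algebra.
From mathcomp Require Import boolp classical_sets ring.

Set Implicit Arguments.
Unset Strict Implicit.
Unset Printing Implicit Defensive.

Import GRing.Theory.
Local Open Scope ring_scope.

(* As F_0 = x^2 (a1 x + a0) with a0 <> 0, one has F = Q (x^2 - e1 x + e2) with
   Q(0, 0) = a0 and e1, e2 divisible by t, so that
   Delta(F, x)(0, t) = Q(0, t)^2 (e1^2 - 4 e2).  Comparing the coefficients of x
   in F gives this product modulo t^4: the t^2 term vanishes because
   b0^2 = a0 c0, and the t^3 term is the claimed value divided by a0^2.
   In particular e1^2 - 4 e2 is t^3 times a unit, hence a square in powers of
   t^(1/2), and the third root, if any, is simple and comes from Hensel's lemma;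
   so the t-roots do exist with N = 2. *)

(** * Coefficients, monomials and lowest terms of formal power series *)

Section FpsCoef.
Variable R : comNzRingType.
Implicit Types (f g : fps R) (a b : R).

(** Reduction modulo the variable; as a ring morphism it extends to polynomials through
    [map_poly]. *)
Definition fcoef0 f : R := fcoef f 0.

Fact fcoef0_is_additive : zmod_morphism fcoef0.
Proof. by []. Qed.

Fact fcoef0_is_multiplicative : monoid_morphism fcoef0.
Proof. by split=> // f g; rewrite /fcoef0 /= big_ord1. Qed.

HB.instance Definition _ :=
  GRing.isZmodMorphism.Build (fps R) R fcoef0 fcoef0_is_additive.
HB.instance Definition _ :=
  GRing.isMonoidMorphism.Build (fps R) R fcoef0 fcoef0_is_multiplicative.

Lemma fcoefD f g n : fcoef (f + g) n = fcoef f n + fcoef g n.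
Proof. by []. Qed.

Lemma fcoefN f n : fcoef (- f) n = - fcoef f n.
Proof. by []. Qed.

Lemma fcoef_zero n : fcoef (0 : fps R) n = 0.
Proof. by rewrite /= if_same. Qed.

Lemma fcoef_constM a f n : fcoef (fps_const a * f) n = a * fcoef f n.
Proof.
by rewrite /= big_ord_recl /= subn0 big1 ?addr0 // => i _; rewrite mul0r.
Qed.

Fact fps_const_is_additive : zmod_morphism (@fps_const R).
Proof.
by move=> a b; apply: fps_eq => n /=; case: eqP => _ //; rewrite subr0.
Qed.

Fact fps_const_is_multiplicative : monoid_morphism (@fps_const R).
Proof.
split=> // a b; apply: fps_eq => n; rewrite fcoef_constM /=.
by case: eqP => _ //; rewrite mulr0.
Qed.

HB.instance Definition _ :=
  GRing.isZmodMorphism.Build R (fps R) (@fps_const R) fps_const_is_additive.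
HB.instance Definition _ :=
  GRing.isMonoidMorphism.Build R (fps R) (@fps_const R)
    fps_const_is_multiplicative.

Definition fps_mono m : fps R := Fps (fun n => (n == m)%:R).

Lemma fcoef_monoM m f n :
  fcoef (fps_mono m * f) n = if (n < m)%N then 0 else fcoef f (n - m).
Proof.
rewrite /=; case: ltnP => [lt_nm | le_mn].
  rewrite big1 // => i _; rewrite [_ == m]negbTE ?mul0r // neq_ltn.
  by rewrite (leq_trans (ltn_ord i)).
rewrite (bigD1 (Ordinal (le_mn : m < n.+1)%N)) //= eqxx mul1r.
rewrite big1 ?addr0 // => i; rewrite -val_eqE /= => /negbTE->.
by rewrite mul0r.
Qed.

Lemma fps_monoP m f :
  (forall n, (n < m)%N -> fcoef f n = 0) -> exists g, f = fps_mono m * g.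
Proof.
move=> f0; exists (Fps (fun n => fcoef f (n + m))); apply: fps_eq => n.
by rewrite fcoef_monoM; case: ltnP => [/f0// | /subnK /= ->].
Qed.

Lemma fps_mono0 : fps_mono 0 = 1.
Proof. by apply: fps_eq => -[|n]. Qed.

Lemma fps_monoX m n : fps_mono m ^+ n = fps_mono (m * n)%N.
Proof.
elim: n => [|n IHn]; first by rewrite muln0 fps_mono0.
rewrite exprS IHn; apply: fps_eq => i; rewrite fcoef_monoM /= mulnS.
case: ltnP => [lt_im | /subnKC {2}<-]; last by rewrite eqn_add2l.
by rewrite [_ == _]negbTE // neq_ltn ltn_addr.
Qed.

Lemma fps_lowE f n :
  (forall i, (i < n)%N -> fcoef f i = 0) -> fcoef f n != 0 ->
  fps_low f = fcoef f n.
Proof.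
move=> f0 fn; rewrite /fps_low; case: pselect => [ex | []]; last by exists n.
case: ex_minnP => m fm min_m.
suff -> : m = n by [].
apply/eqP; rewrite eqn_leq min_m //= leqNgt.
by apply: contra fm => /f0 ->.
Qed.

End FpsCoef.

(** * Hensel's lemma over [fps L], with inverses and square roots as consequences *)

Lemma horner_add_order2 (R : comNzRingType) (p : {poly R}) (x h : R) :
  exists q, p.[x + h] = p.[x] + p^`().[x] * h + h * h * q.
Proof.
elim/poly_ind: p => [|p c [q IHp]].
  by exists 0; rewrite deriv0 !horner0; ring.
exists (p^`().[x] + x * q + h * q).
rewrite derivMXaddC !hornerE IHp.
ring.
Qed.

Section Hensel.
Variables (L : fieldType) (p : {poly fps L}) (c : L).
Hypothesis root_c : root (map_poly (@fcoef0 L) p) c.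
Hypothesis simple_c : ~~ root (map_poly (@fcoef0 L) p)^`() c.

Let d := (map_poly (@fcoef0 L) p)^`().[c].

(** Newton iteration, one coefficient at a time. Dividing by the fixed slope [d] suffices, since at
    order [m.+1] only the constant term of the derivative enters. *)
Fixpoint hensel_approx n : fps L :=
  if n is m.+1 then
    let r := hensel_approx m in
    r - fps_mono L m.+1 * fps_const (fcoef p.[r] m.+1 / d)
  else fps_const c.

Lemma hensel_approxS n i : (i <= n)%N ->
  fcoef (hensel_approx n.+1) i = fcoef (hensel_approx n) i.
Proof.
by move=> le_in; rewrite fcoefD fcoefN fcoef_monoM ltnS le_in oppr0 addr0.
Qed.

Lemma hensel_approx_le n i : (i <= n)%N ->
  fcoef (hensel_approx n) i = fcoef (hensel_approx i) i.
Proof.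
elim: n => [|n IHn]; first by rewrite leqn0 => /eqP->.
rewrite leq_eqVlt => /predU1P[-> // | le_in].
by rewrite hensel_approxS // IHn.
Qed.

Lemma fcoef0_hensel n : fcoef0 (hensel_approx n) = c.
Proof. by rewrite /fcoef0 hensel_approx_le. Qed.

Lemma hensel_approxP n i : (i <= n)%N -> fcoef p.[hensel_approx n] i = 0.
Proof.
elim: n i => [|n IHn] i.
  rewrite leqn0 => /eqP->; rewrite -[LHS]/(fcoef0 _) -horner_map.
  exact/eqP.
set r := hensel_approx n; move=> le_in.
have [q] := horner_add_order2 p r
  (- (fps_mono L n.+1 * fps_const (fcoef p.[r] n.+1 / d))).
rewrite -[r - _]/(hensel_approx n.+1) => ->.
set m := fps_mono L n.+1; set a := fps_const _.
(* The quadratic term carries a second factor [m], so at order [n.+1] only the linear correction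
   survives, and [a] was chosen to make it cancel. *)
have -> : p.[r] + p^`().[r] * - (m * a) + - (m * a) * - (m * a) * q
  = p.[r] + m * (a * (m * (a * q)) - a * p^`().[r]) by ring.
rewrite fcoefD fcoef_monoM; case: ltnP => [lt_in | le_ni].
  by rewrite IHn // add0r.
have {le_in le_ni}-> : i = n.+1 by apply/eqP; rewrite eqn_leq le_in.
rewrite subnn fcoefD fcoefN !fcoef_constM fcoef_monoM mulr0 add0r.
rewrite -[fcoef p^`().[r] 0]/(fcoef0 _) -horner_map /= fcoef0_hensel -deriv_map.
by rewrite -/d divfK ?subrr.
Qed.

(** The root is the diagonal limit: coefficient [n] is frozen from stage [n] on, so [r] agrees with
    stage [n] up to order [n], and by Taylor expansion so do the values of [p]. *)
Lemma hensel : exists2 r : fps L, root p r & fcoef0 r = c.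
Proof.
pose r := Fps (fun n => fcoef (hensel_approx n) n).
exists r; last exact: (fcoef0_hensel 0).
apply/eqP/fps_eq => n; rewrite fcoef_zero.
have [g rE] : exists g, r - hensel_approx n = fps_mono L n.+1 * g.
  apply: fps_monoP => i le_in.
  by rewrite fcoefD fcoefN (@hensel_approx_le n) // subrr.
have [q] := horner_add_order2 p (hensel_approx n) (r - hensel_approx n).
rewrite addrC subrK rE => ->.
set m := fps_mono L n.+1; set s := hensel_approx n.
have -> : p.[s] + p^`().[s] * (m * g) + m * g * (m * g) * q
  = p.[s] + m * (g * p^`().[s] + g * (m * g) * q) by ring.
by rewrite fcoefD fcoef_monoM leqnn hensel_approxP // addr0.
Qed.

End Hensel.

(** Hensel's lemma for the linear polynomial [f X - 1], whose slope is [fcoef0 f] modulo the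
    variable. *)
Lemma fps_inv_ex (L : fieldType) (f : fps L) :
  fcoef0 f != 0 -> exists g, f * g = 1.
Proof.
move=> f0.
have mapE : map_poly (@fcoef0 L) (f *: 'X - 1) = fcoef0 f *: 'X - 1.
  by rewrite rmorphB rmorph1 /= map_polyZ map_polyX.
have root_f : root (map_poly (@fcoef0 L) (f *: 'X - 1)) (fcoef0 f)^-1.
  by rewrite mapE rootE !hornerE divff ?subrr.
have [|g /eqP g1 _] := hensel root_f.
  by rewrite mapE rootE derivB derivZ derivX -polyC1 derivC subr0 !hornerE.
by exists g; move: g1; rewrite !hornerE => /eqP; rewrite subr_eq0 => /eqP.
Qed.

(** Hensel's lemma for [X^2 - f] at a square root [c] of [fcoef0 f]; the root is simple because the
    slope [2 c] is nonzero. *)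
Lemma fps_sqrt_ex (L : closedFieldType) (f : fps L) :
  2%:R != 0 :> L -> fcoef0 f != 0 -> exists g, f = g ^+ 2.
Proof.
move=> nz2 f0.
have [c c2] : exists c : L, c ^+ 2 = fcoef0 f.
  have /closed_rootP[c] : size ('X^2 - (fcoef0 f)%:P : {poly L}) != 1%N.
    by rewrite size_XnsubC.
  by rewrite rootE !hornerE subr_eq0 => /eqP; exists c.
have nz_c : c != 0 by apply: contraNneq f0 => c0; rewrite -c2 c0 expr0n.
have mapE : map_poly (@fcoef0 L) ('X^2 - f%:P) = 'X^2 - (fcoef0 f)%:P.
  by rewrite rmorphB /= map_polyXn map_polyC.
have root_c : root (map_poly (@fcoef0 L) ('X^2 - f%:P)) c.
  by rewrite mapE rootE !hornerE c2 subrr.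
have [|g /eqP g1 _] := hensel root_c.
  rewrite mapE rootE derivB derivXn derivC subr0 hornerMn hornerXn expr1.
  rewrite -mulr_natl.
  by rewrite mulf_neq0.
by exists g; move: g1; rewrite !hornerE => /eqP; rewrite subr_eq0 => /eqP.
Qed.

(** * Expansion of the discriminant of the quadratic factor *)

(* T stands for t, h for 1/q0, and the r_i collect the terms of F of order >= 4
   in t. *)
Lemma cubic_disc_expansion (R : comNzRingType)
  (T a0 a1 b0 b1 c0 c1 d1 r0 r1 r2 r3 q0 q1 e1 e2 h : R) :
  b0 ^+ 2 = a0 * c0 -> q0 * h = 1 ->
  q0 * e2 = c0 * T ^+ 2 + d1 * T ^+ 3 + T ^+ 4 * r0 ->
  q1 * e2 - q0 * e1 = 2 * b0 * T + c1 * T ^+ 2 + T ^+ 4 * r1 ->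
  q0 - q1 * e1 = a0 + b1 * T + T ^+ 4 * r2 ->
  q1 = a1 + T ^+ 4 * r3 ->
  exists z, a0 ^+ 2 * (q0 ^+ 2 * (e1 ^+ 2 - 4%:R * e2)) =
    T ^+ 3 * (- 4%:R * (- a1 * b0 ^+ 3 + b1 * b0 ^+ 2 * a0
                - c1 * b0 * a0 ^+ 2 + d1 * a0 ^+ 3) + T * z).
Proof.
move=> b0E q0h phi0 phi1 phi2 phi3.
(* The last four hypotheses compare the coefficients of [x^0] to [x^3] in
   [(q0 + q1 x) (x^2 - e1 x + e2)] with those of the family. Below, [e2 = T^2 E], [q0 e1 = T A] and
   [q0 = a0 + T m]. *)
pose g := d1 + T * r0.
pose E := h * (c0 + T * g).
have e2E : e2 = T ^+ 2 * E by rewrite -[e2]mul1r -q0h /E /g; ring: phi0.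
pose B := q1 * E - c1 - T ^+ 2 * r1.
pose A := - 2%:R * b0 + T * B.
have q0e1 : q0 * e1 = T * A.
  have -> : q0 * e1 = q1 * e2 - (q1 * e2 - q0 * e1) by ring.
  by rewrite phi1 e2E /A /B; ring.
have e1E : e1 = T * (h * A).
  by rewrite mulrCA -q0e1 mulrA [h * _]mulrC q0h mul1r.
pose m := b1 + T ^+ 3 * r2 + q1 * (h * A).
have q0E : q0 = a0 + T * m.
  have -> : q0 = (q0 - q1 * e1) + q1 * e1 by ring.
  by rewrite phi2 e1E /m; ring.
(* Modulo [T], [h] inverts [a0]. Multiplying [E], [h * A], [B] and [m] by [a0] therefore makes their
   leading terms polynomial in the coefficients of the family; [u], [v], [w], [x] record the
   remainders. *)
have a0h : a0 * h = 1 - T * (m * h) by rewrite -q0h q0E; ring.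
pose u := g - m * h * (c0 + T * g).
have a0E : a0 * E = c0 + T * u by rewrite mulrA a0h /u; ring.
pose v := B - m * h * A.
have a0e : a0 * (h * A) = - 2%:R * b0 + T * v by rewrite mulrA a0h /v /A; ring.
pose w := T ^+ 3 * r3 * c0 + q1 * u - T * a0 * r1.
have a0B : a0 * B = a1 * c0 - a0 * c1 + T * w.
  have -> : a0 * B = q1 * (a0 * E) - a0 * c1 - a0 * T ^+ 2 * r1.
    by rewrite /B; ring.
  by rewrite a0E /w mulrDr {1}phi3; ring.
pose x := a0 * T ^+ 2 * r2 - 2%:R * b0 * T ^+ 3 * r3 + q1 * v.
have a0m : a0 * m = a0 * b1 - 2%:R * a1 * b0 + T * x.
  have -> : a0 * m = a0 * b1 + a0 * T ^+ 3 * r2 + q1 * (a0 * (h * A)).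
    by rewrite /m; ring.
  by rewrite a0e /x mulrDr {1}phi3; ring.
exists (a0 ^+ 2 * (B ^+ 2 - 4%:R * (a0 * r0 + m * g))
  - 4%:R * a0 * (b0 * w + c0 * x)).
have -> : q0 ^+ 2 * (e1 ^+ 2 - 4%:R * e2)
    = (q0 * e1) ^+ 2 - 4%:R * q0 * (q0 * e2) by ring.
rewrite q0e1 phi0 [in X in _ - X]q0E /A.
(* The term of order two in [T] is split off with its factor [b0 ^+ 2 - a0 * c0], which vanishes. *)
transitivity (T ^+ 3 * (a0 ^+ 2 * (T * (B ^+ 2 - 4%:R * (a0 * r0 + m * g)))
   - 4%:R * a0 * (b0 * (a0 * B) + a0 * (a0 * d1) + c0 * (a0 * m)))
   + 4%:R * T ^+ 2 * a0 ^+ 2 * (b0 ^+ 2 - a0 * c0)).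
  by rewrite /g; ring.
rewrite b0E subrr a0B a0m.
transitivity (T ^+ 3 * (- 4%:R * (- a1 * b0 * (a0 * c0) + b1 * a0 * (a0 * c0)
                - c1 * b0 * a0 ^+ 2 + d1 * a0 ^+ 3) +
   T * (a0 ^+ 2 * (B ^+ 2 - 4%:R * (a0 * r0 + m * g))
      - 4%:R * a0 * (b0 * w + c0 * x)))).
  by ring.
by rewrite -b0E; ring.
Qed.

(** * Passage from [A[[t]]] to [L[[t^(1/N)]]] *)

Section Ramify.
Variables (A : idomainType) (L : closedFieldType).
Variables (iota : {rmorphism {fraction A} -> L}) (N : nat).
Hypothesis N_gt0 : (0 < N)%N.
Local Notation j := (iota \o @tofrac A).

Lemma ramify_shift (f : fps A) :
  ramify iota N f = fps_const (j (fcoef f 0)) +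
    fps_mono L N * ramify iota N (Fps (fun m => fcoef f m.+1)).
Proof.
apply: fps_eq => m; rewrite fcoefD fcoef_monoM /=.
case: ltnP => [lt_mN | le_Nm].
  case: m lt_mN => [|m] lt_mN; first by rewrite dvdn0 div0n addr0.
  by rewrite gtnNdvd ?addr0.
rewrite [_ == 0%N]negbTE ?add0r -?lt0n ?(leq_trans N_gt0) //.
rewrite -{1 2}(subnK le_Nm) dvdn_addl // divnDr // divnn N_gt0 addn1.
by case: ifP.
Qed.

(** Order four is the right cut: the vertex is read off at [t^3], and the family is prescribed only
    up to [O(t^4)]. *)
Lemma ramify_expansion4 (f : fps A) : exists r : fps L,
  ramify iota N f = fps_const (j (fcoef f 0))
    + fps_const (j (fcoef f 1)) * fps_mono L N
    + fps_const (j (fcoef f 2)) * fps_mono L N ^+ 2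
    + fps_const (j (fcoef f 3)) * fps_mono L N ^+ 3 + fps_mono L N ^+ 4 * r.
Proof.
pose g i := Fps (fun m => fcoef f (m + i)).
have shift i : ramify iota N (g i) =
    fps_const (j (fcoef f i)) + fps_mono L N * ramify iota N (g i.+1).
  rewrite ramify_shift; congr (_ + _ * ramify _ _ _).
  by apply: fps_eq => m /=; rewrite addSnnS.
have -> : ramify iota N f = ramify iota N (g 0%N).
  by congr ramify; apply: fps_eq => m /=; rewrite addn0.
exists (ramify iota N (g 4%N)).
rewrite (shift 0%N) (shift 1%N) (shift 2%N) (shift 3%N).
by move: (ramify _ _ _) (fps_mono _ _) => r T; ring.
Qed.

Lemma fcoef0_ramify (f : fps A) :
  fcoef0 (ramify iota N f) = j (fcoef f 0).
Proof. by rewrite /fcoef0 /= dvdn0 div0n. Qed.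

Lemma coef_rpoly n (F : nat -> {poly A}) i : poly_family n F ->
  (rpoly iota N F)`_i = ramify iota N (Fps (fun m => (F m)`_i)).
Proof.
case=> sizeF0 sizeF; rewrite coef_map_id0; last first.
  by apply: fps_eq => m; rewrite /= !if_same !rmorph0 if_same.
congr ramify; rewrite coef_poly; case: ltnP => // le_i.
apply: fps_eq => m; rewrite fcoef_zero /= nth_default //.
by rewrite (leq_trans (sizeF m)) // -sizeF0.
Qed.

(** The degree does not drop, because the top coefficient reduces modulo [t] to the image of the
    leading coefficient of [F 0]. *)
Lemma size_rpoly n (F : nat -> {poly A}) : poly_family n F ->
  size (rpoly iota N F) = n.+1.
Proof.
move=> famF; have [sizeF0 sizeF] := famF.
apply/eqP; rewrite eqn_leq; apply/andP; split.
  rewrite (leq_trans (size_poly _ _)) // -sizeF0.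
  exact: size_poly.
apply: contraT; rewrite -leqNgt => le_n.
have := nth_default 0 le_n; rewrite (coef_rpoly _ famF).
move/(congr1 (@fcoef0 L)); rewrite fcoef0_ramify rmorph0 => /eqP.
rewrite /= fmorph_eq0 tofrac_eq0 -[n]/(n.+1.-1) -sizeF0.
by rewrite -lead_coefE lead_coef_eq0 -size_poly_eq0 sizeF0.
Qed.

Lemma fcoef0_rpoly n (F : nat -> {poly A}) : poly_family n F ->
  map_poly (@fcoef0 L) (rpoly iota N F) = map_poly j (F 0%N).
Proof.
move=> famF; apply/polyP => i.
by rewrite coef_map /= (coef_rpoly _ famF) fcoef0_ramify coef_map.
Qed.

End Ramify.

(** * Monic quadratic polynomials over power series *)

(** Parametrised by the elementary symmetric functions of the roots, so that the factor over the
    double root 0 can be handled before its roots are constructed. *)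
Definition fps_quad (R : comNzRingType) (e1 e2 : fps R) : {poly fps R} :=
  'X^2 - e1 *: 'X + e2%:P.

Lemma fps_quad_split (R : comNzRingType) (s1 s2 : fps R) :
  ('X - s1%:P) * ('X - s2%:P) = fps_quad (s1 + s2) (s1 * s2).
Proof. by rewrite /fps_quad -mul_polyC polyCD polyCM; ring. Qed.

Lemma size_fps_quad_tail (R : comNzRingType) (e1 e2 : fps R) :
  (size (- (e1 *: 'X) + e2%:P : {poly fps R})%R <= 2)%N.
Proof.
rewrite (leq_trans (size_polyD _ _)) // geq_max size_polyN.
rewrite (leq_trans (size_scale_leq _ _)) ?size_polyX //.
by rewrite (leq_trans (size_polyC_leq1 _)).
Qed.

Lemma size_fps_quad (R : comNzRingType) (e1 e2 : fps R) :
  size (fps_quad e1 e2) = 3%N.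
Proof.
by rewrite /fps_quad -addrA size_polyDl size_polyXn // ltnS size_fps_quad_tail.
Qed.

Lemma fps_quad_monic (R : comNzRingType) (e1 e2 : fps R) :
  fps_quad e1 e2 \is monic.
Proof.
apply/eqP; rewrite /fps_quad -addrA lead_coefDl ?lead_coefXn // size_polyXn.
by rewrite ltnS size_fps_quad_tail.
Qed.

Lemma fcoef0_fps_quad (R : comNzRingType) (e1 e2 : fps R) :
  map_poly (@fcoef0 R) (fps_quad e1 e2)
  = 'X^2 - fcoef0 e1 *: 'X + (fcoef0 e2)%:P.
Proof.
rewrite /fps_quad rmorphD rmorphB /= map_polyXn map_polyZ.
by rewrite map_polyX map_polyC.
Qed.

Lemma prod_ltn2 (R : pzSemiRingType) (G : 'I_2 -> 'I_2 -> R) :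
  \prod_(i < 2) \prod_(i' < 2 | (i < i')%N) G i i' = G ord0 (lift ord0 ord0).
Proof.
rewrite big_ord_recl big_ord1 [X in X * _]big_mkcond [X in _ * X]big_mkcond.
by rewrite !big_ord_recl !big_ord0 /= !mulr1 !mul1r.
Qed.

(** * Families of the third kind: reduction modulo [t] and discriminant *)

Section ThirdKind.
Variables (A : idomainType) (L : closedFieldType).
Variable iota : {rmorphism {fraction A} -> L}.
Local Notation j := (iota \o @tofrac A).
Variables (n : nat) (F : nat -> {poly A}).
Hypothesis family_F : poly_family n F.
Variables a0 a1 b0 b1 c0 c1 d1 : A.
Hypotheses (F0 : F 0%N = a0 *: 'X^2 + a1 *: 'X^3)
  (F1 : F 1%N = (2 * b0) *: 'X + b1 *: 'X^2)
  (F2 : F 2%N = c0%:P + c1 *: 'X)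
  (F3 : F 3%N = d1%:P).
Hypothesis disc0 : b0 ^+ 2 = a0 * c0.
Hypothesis a0_neq0 : j a0 != 0.

Local Notation f2 := (a1 *: 'X + a0%:P).
Let cusp := - 4%:R * (- a1 * b0 ^+ 3 + b1 * b0 ^+ 2 * a0
                - c1 * b0 * a0 ^+ 2 + d1 * a0 ^+ 3).

Lemma map_f2 : map_poly j f2 = j a1 *: 'X + (j a0)%:P.
Proof. by rewrite rmorphD /= map_polyZ map_polyX map_polyC. Qed.

Lemma root_f2 r : j a1 != 0 ->
  root (map_poly j f2) r = (r == - (j a0 / j a1)).
Proof.
move=> a1_neq0.
by rewrite map_f2 -[(j a0)%:P]opprK -polyCN root_ZXsubC // mulNr.
Qed.

(** Only an inequality: [a1] may vanish, and then [n] is 2. *)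
Lemma family_deg : (n <= 3)%N.
Proof.
rewrite -ltnS -(proj1 family_F) F0 (leq_trans (size_polyD _ _)) // geq_max.
by rewrite !(leq_trans (size_scale_leq _ _)) ?size_polyXn.
Qed.

Section Ramified.
Variable N : nat.
Hypothesis N_gt0 : (0 < N)%N.
Local Notation T := (fps_mono L N).
Local Notation P := (rpoly iota N F).

Lemma fcoef0_third_kind :
  map_poly (@fcoef0 L) P = map_poly j f2 * 'X^2.
Proof.
rewrite (fcoef0_rpoly _ _ family_F) F0 map_f2 rmorphD /= !map_polyZ.
by rewrite !map_polyXn -!mul_polyC; ring.
Qed.

(** The quadratic factor reduces to [X^2], which is monic and hence cancels, so that [Q] reduces to
    [f2]. *)
Lemma third_kind_cofactor0 Q e1 e2 :
    P = Q * fps_quad e1 e2 -> fcoef0 e1 = 0 -> fcoef0 e2 = 0 ->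
  fcoef0 Q`_0 = j a0.
Proof.
move=> PE e10 e20; rewrite -coef_map /=.
have -> : map_poly (@fcoef0 L) Q = map_poly j f2.
  apply: (@monic_rreg _ 'X^2); first exact: monicXn.
  have := fcoef0_third_kind.
  by rewrite PE rmorphM /= fcoef0_fps_quad e10 e20 scale0r subr0 addr0.
by rewrite map_f2 !coefE /= mulr0 add0r.
Qed.

(** As [Q] has degree at most 1 in [x], the coefficients of [x^0] to [x^3] give exactly the four
    equations of [cubic_disc_expansion]. *)
Lemma third_kind_disc Q e1 e2 :
    P = Q * fps_quad e1 e2 -> fcoef0 e1 = 0 -> fcoef0 e2 = 0 ->
  exists z, fps_const (j a0) ^+ 2 * (Q`_0 ^+ 2 * (e1 ^+ 2 - 4%:R * e2)) =
    T ^+ 3 * (fps_const (j cusp) + T * z).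
Proof.
move=> PE e10 e20.
have sizeQ : (size Q <= 2)%N.
  have [-> | nzQ] := eqVneq Q 0; first by rewrite size_poly0.
  have := size_rpoly iota N family_F.
  rewrite PE size_Mmonic ?fps_quad_monic // size_fps_quad addn3 /= => -[sQ].
  by rewrite -ltnS sQ family_deg.
have [Q2 Q3] : Q`_2 = 0 /\ Q`_3 = 0.
  by split; rewrite nth_default // (leq_trans sizeQ).
have PE' : P = Q * 'X^2 - e1 *: (Q * 'X) + e2 *: Q.
  by rewrite PE /fps_quad -!mul_polyC; ring.
have [h Qh] : exists h, Q`_0 * h = 1.
  by apply: fps_inv_ex; rewrite (third_kind_cofactor0 PE).
have [r0 P0] := ramify_expansion4 iota N_gt0 (Fps (fun m => (F m)`_0)).
have [r1 P1] := ramify_expansion4 iota N_gt0 (Fps (fun m => (F m)`_1)).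
have [r2 P2] := ramify_expansion4 iota N_gt0 (Fps (fun m => (F m)`_2)).
have [r3 P3] := ramify_expansion4 iota N_gt0 (Fps (fun m => (F m)`_3)).
move: P0 P1 P2 P3; rewrite -!(coef_rpoly iota N _ family_F) PE'.
pose c := (@fps_const L \o j : {rmorphism A -> fps L}).
rewrite /= F0 F1 F2 F3 !coefE /= Q2 Q3.
rewrite !(mulr0, mulr1, mul0r, addr0, add0r, subr0, sub0r, oppr0, rmorph0).
rewrite /= => P0 P1 P2 P3.
have [||||||z zE] := @cubic_disc_expansion _ T (c a0) (c a1) (c b0) (c b1)
  (c c0) (c c1) (c d1) r0 r1 r2 r3 Q`_0 Q`_1 e1 e2 h.
- by rewrite -rmorphXn disc0 rmorphM.
- by [].
- by rewrite mulrC P0.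
- by rewrite mulrC addrC [_ * e1]mulrC P1
    -[fps_const (iota (tofrac (2 * b0)))]/(c _) rmorphM rmorph_nat.
- by rewrite mulrC P2.
- by rewrite P3.
exists z; rewrite zE -[fps_const (j cusp)]/(c cusp) /cusp.
by rewrite !(rmorph_nat, rmorphXn, rmorphD, rmorphM, rmorphN).
Qed.

End Ramified.

(** * All admissible choices give the same vertex *)

Hypothesis two_neq0 : 2%:R != 0 :> L.
Hypothesis cusp_neq0 : j cusp != 0.
Local Notation fs := [:: ('X, 2%N); (f2, 1%N)].

(** The roots come from a choice, but comparing sizes forces a list of length one, whose entry is a
    root of [x]. *)
Lemma res_rootsX : res_roots iota 'X = [:: 0].
Proof.
rewrite /res_roots; case: closed_field_poly_normal => r /=.
rewrite (map_polyX j) lead_coefX scale1r => rE.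
have := size_polyX L; rewrite rE size_prod_XsubC => -[].
case: r rE => [|z [|//]] //; rewrite big_seq1 => /(congr1 (horner^~ z)).
by rewrite !hornerE subrr => ->.
Qed.

Lemma Res_X : Res iota 'X f2 = j a0.
Proof.
rewrite /Res res_rootsX big_seq1 lead_coefX !rmorph1 expr1n mul1r.
by rewrite -[map_poly _ _]/(map_poly j _) map_f2 !hornerE.
Qed.

(** The lowest coefficient of Delta(F, x)(0, t) is [j cusp / j a0 ^+ 2], and the resultant [j a0]
    enters with exponent 2 (2 + 1 - 2) = 2, which cancels the denominator. *)
Lemma vertex_unique v : is_vertex iota F fs v -> v = j cusp.
Proof.
case=> _ [N [rs [D [N_gt0 _ disc ->]]]].
(* For multiplicity 1 the power of [Q] has exponent 0 and there is no pair of indices. *)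
have D2 : D (lift ord0 ord0) = 1.
  have [Q [s [_ _ _ ->]]] := disc (lift ord0 ord0).
  by rewrite /= expr0 mul1r big_ord1 big_mkcond big_ord1.
have [Q [s [_ PE s0 D1]]] := disc ord0.
rewrite /= in PE s0 D1.
rewrite prod_ltn2 /= !big_ord_recl !big_ord0 /= res_rootsX big_seq1 D2 Res_X.
(* Each root of [f2] contributes the lowest coefficient of 1, so the list of these roots need not be
   known. *)
rewrite [X in _ * (X * _) * _]big1 ?mulr1 ?mul1r; last first.
  by move=> a _; rewrite hornerC (@fps_lowE _ _ 0) ?oner_eq0.
pose s1 := (s ord0)`_0; pose s2 := (s (lift ord0 ord0))`_0.
(* For [f = x] the degree bound leaves size at most 1: each [s i] is constant in [x], hence a t-root
   over 0. *)
have sE i : s i = ((s i)`_0)%:P.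
  by apply: size1_polyC; have [] := s0 i; rewrite size_polyX.
have quadE : rpoly iota N F = Q * fps_quad (s1 + s2) (s1 * s2).
  rewrite PE -fps_quad_split !big_ord_recl big_ord0 mulr1 /=.
  by rewrite (map_polyX (@fps_const L \o j)) (sE ord0) (sE (lift ord0 ord0)).
have [s10 s20] : fcoef0 s1 = 0 /\ fcoef0 s2 = 0.
  by split; apply: (proj2 (s0 _)).
have [||z zE] := third_kind_disc N_gt0 quadE.
- by rewrite rmorphD /= s10 s20 addr0.
- by rewrite rmorphM /= s10 mul0r.
have {D1} DE : (D ord0).[fps_const 0] = Q`_0 ^+ 2 * (s1 - s2) ^+ 2.
  rewrite D1 rmorph0 prod_ltn2 hornerM !horner_exp hornerD hornerN.
  by rewrite (sE ord0) (sE (lift ord0 ord0)) !hornerC horner_coef0.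
have coefD i : j a0 ^+ 2 * fcoef (D ord0).[fps_const 0] i =
    fcoef (fps_mono L (N * 3)%N * (fps_const (j cusp) + fps_mono L N * z)) i.
  rewrite -fps_monoX -zE DE -fcoef_constM rmorphXn.
  by congr (fcoef (_ * (_ * _)) i); ring.
have a02 : j a0 ^+ 2 != 0 by rewrite expf_neq0.
(* Series are written in [tau] with [t = tau^N], so the term in [t^3] has index [N * 3]. *)
have coefD3 : j a0 ^+ 2 * fcoef (D ord0).[fps_const 0] (N * 3)%N = j cusp.
  by rewrite coefD fcoef_monoM ltnn subnn fcoefD fcoef_monoM N_gt0 addr0.
rewrite (@fps_lowE _ _ (N * 3)%N).
- by rewrite -[RHS]/(j cusp) -coefD3 mulrC.
- move=> i lt_i; apply: (mulfI a02).
  by rewrite coefD fcoef_monoM lt_i mulr0.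
- by apply: contraNneq cusp_neq0 => D0; rewrite -coefD3 D0 mulr0.
Qed.

(** * Existence of the t-roots with [N = 2] *)

Lemma quad_normal (p : {poly fps L}) h : size p = 3%N -> lead_coef p * h = 1 ->
  p = lead_coef p *: fps_quad (- (h * p`_1)) (h * p`_0).
Proof.
move=> sizep; rewrite lead_coefE sizep /= => p2h.
apply/polyP => i; rewrite /fps_quad !coefE.
case: i => [|[|[|i]]] /=; last 1 first.
- by rewrite nth_default ?sizep // mulr0 oppr0 !addr0 mulr0.
- by rewrite mulr0 subr0 add0r mulrA p2h mul1r.
- by rewrite mulr1 sub0r opprK addr0 mulrA p2h mul1r.
- by rewrite mulr0 subr0 addr0 mulr1.
Qed.

(** Compares the coefficients of [X^0], then of [X^1]. Applied to reductions, it shows that [e1] and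
    [e2] have zero constant term. *)
Lemma third_kind_quad_root0 (q : {poly L}) x y : q`_0 != 0 ->
  map_poly j f2 * 'X^2 = q * ('X^2 - x *: 'X + y%:P) -> x = 0 /\ y = 0.
Proof.
move=> q0 E.
have E' : map_poly j f2 * 'X^2 = q * 'X^2 - x *: (q * 'X) + y *: q.
  by rewrite E -!mul_polyC; ring.
have := congr1 (fun p : {poly L} => p`_0) E'.
rewrite !coefE /= mulr0 subr0 add0r => /esym/eqP.
rewrite mulf_eq0 (negPf q0) orbF => /eqP y0.
have := congr1 (fun p : {poly L} => p`_1) E'.
rewrite !coefE /= y0 mul0r addr0 sub0r => /esym/eqP.
by rewrite oppr_eq0 mulf_eq0 (negPf q0) orbF => /eqP.
Qed.

Local Notation P := (rpoly iota 2 F).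
Local Notation u := (lead_coef P).

Lemma third_kind_lead0 : fcoef0 u != 0.
Proof.
rewrite lead_coefE (size_rpoly iota 2 family_F) (coef_rpoly iota 2 _ family_F).
rewrite fcoef0_ramify /= fmorph_eq0 tofrac_eq0 -[n]/(n.+1.-1).
by rewrite -(proj1 family_F) -lead_coefE lead_coef_eq0 -size_poly_eq0
  (proj1 family_F).
Qed.

(** If [j a1] is 0, [P] is quadratic with invertible leading coefficient. Otherwise
    [- (j a0 / j a1)] is a simple root of the reduction, distinct from the double root 0; Hensel's
    lemma lifts it to [r3], and dividing by [X - r3] leaves the quadratic factor. *)
Lemma third_kind_factor : exists rs3 (e1 e2 : fps L),
  [/\ P = (u *: \prod_(r <- rs3) ('X - r%:P)) * fps_quad e1 e2,
      fcoef0 e1 = 0, fcoef0 e2 = 0 &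
      j a1 = 0 /\ rs3 = [::] \/
      j a1 != 0 /\ exists2 r3, rs3 = [:: r3] & fcoef0 r3 = - (j a0 / j a1)].
Proof.
have [h uh] := fps_inv_ex third_kind_lead0.
have F0C := fcoef0_third_kind 2.
have [a10 | a1_neq0] := eqVneq (j a1) 0.
  have sizeP : size P = 3%N.
    rewrite (size_rpoly iota 2 family_F) -(proj1 family_F) F0.
    move/eqP: a10; rewrite /= fmorph_eq0 tofrac_eq0 => /eqP->.
    rewrite scale0r addr0 size_scale ?size_polyXn //.
    by move: a0_neq0; rewrite /= fmorph_eq0 tofrac_eq0.
  have PE := quad_normal sizeP uh.
  set e1 := - _ in PE; set e2 := h * _ in PE.
  have [||e10 e20] := @third_kind_quad_root0
      (fcoef0 u)%:P (fcoef0 e1) (fcoef0 e2).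
  - by rewrite coefC third_kind_lead0.
  - by rewrite -F0C [in LHS]PE map_polyZ /= fcoef0_fps_quad mul_polyC.
  exists [::], e1, e2; split=> //; last by left.
  by rewrite big_nil -scalerAl mul1r.
pose c := - (j a0 / j a1).
have f2c : root (map_poly j f2) c by rewrite root_f2.
have root_c : root (map_poly (@fcoef0 L) P) c by rewrite F0C rootM f2c.
have [|r3 /factor_theorem[G PG] r30] := hensel root_c.
  (* Since [f2] vanishes at [c], the derivative of [f2 * X^2] there is [j a1 * c^2]. *)
  rewrite F0C rootE derivM hornerD !hornerM (rootP f2c) mul0r addr0.
  rewrite map_f2 derivD derivC derivZ derivX addr0 !hornerE.
  by rewrite !mulf_neq0 // /c oppr_eq0 mulf_neq0 ?invr_eq0.
have uG : u = lead_coef G by rewrite PG lead_coef_Mmonic ?monicXsubC.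
have sizeG : size G = 3%N.
  have nzG : G != 0.
    apply: contraNneq third_kind_lead0 => G0.
    by rewrite uG G0 lead_coef0 rmorph0.
  have : size P = 4%N.
    rewrite (size_rpoly iota 2 family_F) -(proj1 family_F) F0 addrC.
    have a1n : a1 != 0 by move: a1_neq0; rewrite /= fmorph_eq0 tofrac_eq0.
    have size3 : size (a1 *: 'X^3) = 4%N by rewrite size_scale // size_polyXn.
    rewrite size_polyDl size3 //.
    by rewrite ltnS (leq_trans (size_scale_leq _ _)) ?size_polyXn.
  by rewrite PG size_Mmonic ?monicXsubC // size_XsubC addn2 => -[].
have GE := quad_normal sizeG; rewrite -uG in GE; have {}GE := GE h uh.
set e1 := - _ in GE; set e2 := h * _ in GE.
have PE : P = (u *: ('X - r3%:P)) * fps_quad e1 e2.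
  by rewrite [LHS]PG {1}GE -!mul_polyC; ring.
have [||e10 e20] := @third_kind_quad_root0
    (fcoef0 u *: ('X - c%:P)) (fcoef0 e1) (fcoef0 e2).
- by rewrite !coefE /= sub0r /c opprK !mulf_neq0 ?invr_eq0 ?third_kind_lead0.
- rewrite -F0C [in LHS]PE rmorphM /= fcoef0_fps_quad map_polyZ /= rmorphB /=.
  by rewrite map_polyX map_polyC /= r30.
exists [:: r3], e1, e2; split=> //; first by rewrite big_seq1.
by right; split=> //; exists r3.
Qed.

Lemma third_kind_factorization : is_factorization iota F fs.
Proof.
split=> //.
  by rewrite big_cons big_seq1 /= F0 expr1 -!mul_polyC; ring.
rewrite /= !andbT -[map_poly _ 'X]/(map_poly j 'X) map_polyX.
rewrite -[map_poly _ f2]/(map_poly j f2) map_f2.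
by rewrite coprimep_sym coprimepX rootE !hornerE.
Qed.

(** The quadratic formula for [fps_quad e1 e2], whose discriminant becomes a square once [t] is
    one. *)
Lemma third_kind_roots : exists rs3 s1 s2,
  [/\ P = (u *: \prod_(r <- rs3) ('X - r%:P)) * (('X - s1%:P) * ('X - s2%:P)),
      fcoef0 s1 = 0, fcoef0 s2 = 0 &
      j a1 = 0 /\ rs3 = [::] \/
      j a1 != 0 /\ exists2 r3, rs3 = [:: r3] & fcoef0 r3 = - (j a0 / j a1)].
Proof.
have [rs3 [e1 [e2 [PE e10 e20 rs3E]]]] := third_kind_factor.
set Q := u *: _ in PE; exists rs3.
have [//|z zE] := @third_kind_disc 2 _ _ _ _ PE e10 e20.
have [|w wE] := @fps_sqrt_ex _ (fps_const (j cusp) + fps_mono L 2 * z) two_neq0.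
  by rewrite rmorphD rmorphM /= mul0r addr0.
have [|h hE] := @fps_inv_ex _ (fps_const (j a0) * Q`_0).
  by rewrite rmorphM /= (third_kind_cofactor0 PE e10 e20) mulf_neq0.
(* [w] is a square root of the unit in [zE], [h] inverts [a0 * Q(0, t)], and [T ^+ 3 = tau^6] has
   the square root [tau^3]. *)
pose delta := fps_mono L 3 * (w * h).
have deltaE : delta ^+ 2 = e1 ^+ 2 - 4%:R * e2.
  transitivity ((fps_const (j a0) * Q`_0 * h) ^+ 2 * (e1 ^+ 2 - 4%:R * e2)).
    transitivity
      (fps_const (j a0) ^+ 2 * (Q`_0 ^+ 2 * (e1 ^+ 2 - 4 * e2)) * h ^+ 2).
      by rewrite zE wE /delta !exprMn !fps_monoX mulrA.
    by ring.
  by rewrite hE expr1n mul1r.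
have delta0 : fcoef0 delta = 0 by rewrite rmorphM /= mul0r.
pose half := fps_const (2%:R^-1 : L).
have halfE : half * 2%:R = 1.
  by rewrite -(rmorph_nat (@fps_const L)) -rmorphM mulVf // rmorph1.
have e1E : half * (e1 + delta) + half * (e1 - delta) = e1.
  transitivity (half * 2%:R * e1); last by rewrite halfE mul1r.
  by ring.
have e2E : half * (e1 + delta) * (half * (e1 - delta)) = e2.
  transitivity (half ^+ 2 * (e1 ^+ 2 - delta ^+ 2)); first by ring.
  transitivity ((half * 2%:R) ^+ 2 * e2); last by rewrite halfE expr1n mul1r.
  by rewrite deltaE; ring.
have half0 x : fcoef0 x = 0 -> fcoef0 (half * x) = 0.
  by move=> x0; rewrite rmorphM /= x0 mulr0.
exists (half * (e1 + delta)), (half * (e1 - delta)); split=> //.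
- by rewrite fps_quad_split e1E e2E.
- by rewrite half0 // -[LHS]/(fcoef0 e1 + fcoef0 delta) e10 delta0 addr0.
- by rewrite half0 // -[LHS]/(fcoef0 e1 - fcoef0 delta) e10 delta0 subr0.
Qed.

(** * Existence of a vertex *)

Lemma root_mapX r : root (map_poly j 'X) r = (r == 0).
Proof. by rewrite map_polyX rootX. Qed.

Lemma map_const_X :
  map_poly (fun a => fps_const (iota (tofrac a))) 'X = 'X :> {poly fps L}.
Proof. exact: (map_polyX (@fps_const L \o j)). Qed.

Lemma map_const_f2 : map_poly (fun a => fps_const (iota (tofrac a))) f2 =
  fps_const (j a1) *: 'X + (fps_const (j a0))%:P :> {poly fps L}.
Proof.
rewrite -[LHS]/(map_poly (@fps_const L \o j) f2) rmorphD /= map_polyZ.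
by rewrite map_polyX map_polyC.
Qed.

Lemma vertex_exists : exists v, is_vertex iota F fs v.
Proof.
have [rs3 [s1 [s2 [PE s10 s20 rs3E]]]] := third_kind_roots.
pose rs := [:: s1, s2 & rs3].
have rootsP : t_roots iota 2 F rs.
  by rewrite /t_roots [LHS]PE /rs !big_cons -!mul_polyC; ring.
have disc1 : exists D, is_gen_disc iota 2 F rs 'X 2 D.
  (* [D] is left open, to be filled by its defining formula. The third t-root, if present, has
     nonzero constant term and stays in [Q]. *)
  eexists; exists (u *: \prod_(r <- rs3) ('X - r%:P)).
  exists (fun i : 'I_2 => if i == ord0 then s1%:P else s2%:P).
  split; last by reflexivity.
  - rewrite map_const_X lead_coefX expr1n scale1r /rs !big_cons !root_mapX.
    rewrite -![fcoef _ 0]/(fcoef0 _) s10 s20 eqxx /=.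
    case: rs3E => [[_ ->] | [a1_neq0 [r3 -> r30]]]; first by rewrite !big_nil.
    rewrite !big_cons root_mapX -[fcoef _ 0]/(fcoef0 _) r30 oppr_eq0 mulf_eq0.
    by rewrite invr_eq0 (negPf a0_neq0) (negPf a1_neq0) !big_nil.
  - by rewrite map_const_X !big_ord_recl big_ord0 mulr1 [LHS]PE.
  - by move=> i; rewrite size_polyX /=; case: ifP => _;
      split=> [|l]; rewrite ?size_polyC_leq1 // coefC; case: ifP.
have disc2 : exists D, is_gen_disc iota 2 F rs f2 1 D.
  case: rs3E => [[a10 rs3E] | [a1_neq0 [r3 rs3E r30]]].
    have a10' : a1 = 0.
      by move/eqP: a10; rewrite /= fmorph_eq0 tofrac_eq0 => /eqP.
    have invE : fps_const (j a0) * fps_const (j a0)^-1 = 1.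
      by rewrite -rmorphM divff ?rmorph1.
    (* Here [f2] is the constant [a0], so no t-root lies over it: [s] is 0 and [Q] absorbs the
       inverse of [a0]. *)
    eexists; exists ((fps_const (j a0)^-1) *: P), (fun _ => 0).
    split; last by reflexivity.
    - rewrite map_const_f2 a10 rmorph0 scale0r add0r lead_coefC expr1 scalerA.
      rewrite invE scale1r -big_filter.
      rewrite (eq_filter (a2 := predT)) ?filter_predT // => r.
      rewrite -[map_poly _ _]/(map_poly j f2) map_f2 a10 scale0r add0r.
      by rewrite rootC a0_neq0.
    - rewrite map_const_f2 a10 rmorph0 scale0r add0r big_ord1 subr0.
      by rewrite mulrC mul_polyC scalerA invE scale1r.
    - by move=> i; rewrite size_poly0; split=> // l; rewrite coef0.
  have invE : fps_const (j a1) * fps_const (j a1)^-1 = 1.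
    by rewrite -rmorphM divff ?rmorph1.
  have c_neq0 : fps_const (j a1) != 0.
    by apply: contraNneq a1_neq0 => /(congr1 (@fcoef0 L)) /eqP.
  have leadE : lead_coef (fps_const (j a1) *: 'X + (fps_const (j a0))%:P)
      = fps_const (j a1).
    rewrite lead_coefE -mul_polyC size_MXaddC polyC_eq0 (negPf c_neq0) /=.
    by rewrite size_polyC c_neq0 mul_polyC !coefE /= mulr1 addr0.
  (* The choice of [s] makes [f2 - s] equal to [a1 (x - r3)], and [Q] compensates the factor [a1];
     [s] vanishes at [t = 0] because [r3] starts with [- a0 / a1]. *)
  eexists; exists (fps_const (j a1)^-1 *: (u *: (('X - s1%:P) * ('X - s2%:P)))).
  exists (fun _ => (fps_const (j a0) + fps_const (j a1) * r3)%:P).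
  split; last by reflexivity.
  - rewrite map_const_f2 leadE expr1 scalerA invE scale1r /rs rs3E !big_cons.
    rewrite !root_f2 // -![fcoef _ 0]/(fcoef0 _) s10 s20 r30 eqxx big_nil mulr1.
    rewrite eq_sym oppr_eq0 mulf_eq0 invr_eq0 (negPf a0_neq0) (negPf a1_neq0).
    by rewrite /= mulr1.
  - rewrite map_const_f2 big_ord1 [LHS]PE rs3E big_seq1.
    transitivity ((fps_const (j a1) * fps_const (j a1)^-1)%:P *
        (u *: ('X - r3%:P) * (('X - s1%:P) * ('X - s2%:P)))).
      by rewrite invE mul1r.
    by rewrite -!mul_polyC !polyCD !polyCM; ring.
  - have a1n : a1 != 0 by move: a1_neq0; rewrite /= fmorph_eq0 tofrac_eq0.
    move=> i; rewrite -mul_polyC size_MXaddC polyC_eq0 (negPf a1n) /=.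
    rewrite (size_polyC a1) a1n size_polyC_leq1; split=> // l.
    rewrite coefC; case: eqP => // _; rewrite fcoefD fcoef_constM.
    rewrite -[fcoef r3 0]/(fcoef0 r3) r30 mulrN mulrCA divff // mulr1.
    exact: subrr.
have [D DP] : exists D : 'I_(size fs) -> {poly fps L},
    forall nu : 'I_(size fs),
      is_gen_disc iota 2 F rs
        (nth (0, 0%N) fs nu).1 (nth (0, 0%N) fs nu).2 (D nu).
  case: disc1 disc2 => D1 D1P [D2 D2P].
  exists (fun nu => if val nu == 0%N then D1 else D2).
  by case=> m lt_m; case: m lt_m => [|[|m]] lt_m.
by eexists; split; [exact: third_kind_factorization | exists 2%N, rs, D].
Qed.

End ThirdKind.

(** * Transfer of the hypotheses to [Kbar] and evaluation of [Ver] *)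

Theorem proposition3p4
  (k : closedFieldType) (char_k : [pchar k] =i pred0)
  (A : idomainType) (alg : {rmorphism k -> A})
  (Kbar : closedFieldType) (iota : {rmorphism {fraction A} -> Kbar})
  (algebraic_Kbar : forall z : Kbar, algebraicOver iota z)
  (n : nat) (F : nat -> {poly A}) (family_F : poly_family n F)
  (a0 a1 b0 b1 c0 c1 d1 : A)
  (F0 : F 0%N = a0 *: 'X^2 + a1 *: 'X^3)
  (F1 : F 1%N = (2 * b0) *: 'X + b1 *: 'X^2)
  (F2 : F 2%N = c0%:P + c1 *: 'X)
  (F3 : F 3%N = d1%:P)
  (disc0 : b0 ^+ 2 - a0 * c0 = 0)
  (nondeg : a0 * (- a1 * b0 ^+ 3 + b1 * b0 ^+ 2 * a0
                  - c1 * b0 * a0 ^+ 2 + d1 * a0 ^+ 3) != 0) :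
  Ver iota F [:: ('X, 2%N); (a1 *: 'X + a0%:P, 1%N)] =
  iota (tofrac (- 4%:R * (- a1 * b0 ^+ 3 + b1 * b0 ^+ 2 * a0
                          - c1 * b0 * a0 ^+ 2 + d1 * a0 ^+ 3))).
Proof.
(* Characteristic zero passes from [k] to [A] because the morphism [alg] out of a field is
   injective. *)
have natr_neq0 m : m.+1%:R != 0 :> A.
  by rewrite -(rmorph_nat alg) fmorph_eq0 (pcharf0P k).1.
have [a0n cusp_n] : a0 != 0 /\ - a1 * b0 ^+ 3 + b1 * b0 ^+ 2 * a0
    - c1 * b0 * a0 ^+ 2 + d1 * a0 ^+ 3 != 0.
  by apply/andP; rewrite -negb_or -mulf_eq0.
move/eqP: disc0; rewrite subr_eq0 => /eqP disc0.
have a0_neq0 : (iota \o @tofrac A) a0 != 0 by rewrite /= fmorph_eq0 tofrac_eq0.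
have two_neq0 : 2%:R != 0 :> Kbar.
  by rewrite -(rmorph_nat (iota \o @tofrac A)) /= fmorph_eq0 tofrac_eq0.
have cusp_neq0 : (iota \o @tofrac A) (- 4%:R * (- a1 * b0 ^+ 3
    + b1 * b0 ^+ 2 * a0 - c1 * b0 * a0 ^+ 2 + d1 * a0 ^+ 3)) != 0.
  by rewrite /= fmorph_eq0 tofrac_eq0 mulf_neq0 ?oppr_eq0.
(* [Ver] chooses some vertex if there is one: existence rules out the default 0, and uniqueness
   gives the value. *)
apply: (vertex_unique family_F F0 F1 F2 F3) => //.
by apply: xgetPex; apply: (vertex_exists family_F F0 F1 F2 F3).
Qed.
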